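(* Let $n,\ell,m_x,m_y$ be positive integers, let $\mathbb{Q}\subset\mathbb{R}^\ell$ be a set, and consider the following two settings. (LMI setting) Let $F_0,F_1,\dots,F_{m_x}:\mathbb{Q}\to\mathbb{R}^{n\times n}$ be arbitrary functions taking values in real symmetric $n\times n$ matrices, set $m_\theta=m_x$, $\theta=x\in\mathbb{R}^{m_x}$, and $F_{\mathrm{LMI}}(\theta,q)=F_0(q)+\sum_{i=1}^{m_x}x_iF_i(q)$. Define $g:\mathbb{R}^{m_\theta}\times\mathbb{Q}\to\{0,1\}$ by $g(\theta,q)=0$ if $F_{\mathrm{LMI}}(\theta,q)\succ0$ (positive definite) and $g(\theta,q)=1$ otherwise. (BMI setting) Let $F_0,F_i,G_j,H_{ij}:\mathbb{Q}\to\mathbb{R}^{n\times n}$ ($i=1,\dots,m_x$, $j=1,\dots,m_y$) be arbitrary functions taking values in real symmetric $n\times n$ matrices, set $m_\theta=m_x+m_y$, $\theta=(x,y)\in\mathbb{R}^{m_x}\times\mathbb{R}^{m_y}$, and $F_{\mathrm{BMI}}(\theta,q)=F_0(q)+\sum_{i=1}^{m_x}x_iF_i(q)+\sum_{j=1}^{m_y}y_jG_j(q)+\sum_{i=1}^{m_x}\sum_{j=1}^{m_y}x_iy_jH_{ij}(q)$. Define $g(\theta,q)=0$ if $F_{\mathrm{BMI}}(\theta,q)\succ0$ and $g(\theta,q)=1$ otherwise. In either setting, the VC-dimension $d$ of the family $\mathcal{G}=\{g(\theta,\cdot):\theta\in\mathbb{R}^{m_\theta}\}$ satisfies $$d\le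 2m_\theta\log_2(4en^2),$$ where $e$ is Euler's number.
   Context: For a family $\mathcal{G}$ of functions $\mathbb{Q}\to\{0,1\}$, a finite set $\{q^{(1)},\dots,q^{(N)}\}\subset\mathbb{Q}$ is shattered by $\mathcal{G}$ if for every subset $S$ of it there is $h\in\mathcal{G}$ with $\{q^{(i)}:h(q^{(i)})=1\}=S$. The VC-dimension of $\mathcal{G}$ is the largest integer $d$ such that some set of $d$ points of $\mathbb{Q}$ is shattered by $\mathcal{G}$. $A\succ0$ means the symmetric matrix $A$ is positive definite. *)

(* Defs.v *)
From HB Require Import structures.
From mathcomp Require Import all_boot all_order all_algebra.
From mathcomp Require Import all_classical all_reals all_analysis.
Set Implicit Arguments. Unset Strict Implicit. Unset Printing Implicit Defensive.
Import Order.TTheory GRing.Theory Num.Theory.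
Local Open Scope ring_scope.
Local Open Scope classical_set_scope.

Section Defs.
Variable R : realType.

Definition symmetric_mx n (A : 'M[R]_n) : Prop := A^T = A.

Definition posdef n (A : 'M[R]_n) : Prop :=
  symmetric_mx A /\ forall v : 'cV[R]_n, v != 0 -> 0 < (v^T *m A *m v) 0 0.

(* A finite set of points (given as a duplicate-free list) is shattered by
   the family G of {0,1}-valued (boolean) functions. *)
Definition shatters (T : eqType) (G : set (T -> bool)) (s : seq T) : Prop :=
  forall s' : seq T, {subset s' <= s} ->
    exists2 h, G h & forall x, x \in s -> h x = (x \in s').

Definition VCdim_le (T : eqType) (D : set T) (G : set (T -> bool)) (b : R) : Prop :=
  forall s : seq T, uniq s -> {subset s <= D} -> shatters G s -> (size s)%:R <= b.

Definition F_LMI n l mx (F0 : 'rV[R]_l -> 'M[R]_n) (F : 'I_mx -> 'rV[R]_l -> 'M[R]_n)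
  (x : 'rV[R]_mx) (q : 'rV[R]_l) : 'M[R]_n :=
  F0 q + \sum_(i < mx) x 0 i *: F i q.

Definition g_LMI n l mx F0 F (x : 'rV[R]_mx) (q : 'rV[R]_l) : bool :=
  ~~ `[< posdef (@F_LMI n l mx F0 F x q) >].

Definition family_LMI n l mx F0 F : set ('rV[R]_l -> bool) :=
  [set @g_LMI n l mx F0 F x | x in [set: 'rV[R]_mx]].

Definition F_BMI n l mx my (F0 : 'rV[R]_l -> 'M[R]_n)
  (F : 'I_mx -> 'rV[R]_l -> 'M[R]_n) (G : 'I_my -> 'rV[R]_l -> 'M[R]_n)
  (H : 'I_mx -> 'I_my -> 'rV[R]_l -> 'M[R]_n)
  (xy : 'rV[R]_mx * 'rV[R]_my) (q : 'rV[R]_l) : 'M[R]_n :=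
  F0 q + \sum_(i < mx) xy.1 0 i *: F i q + \sum_(j < my) xy.2 0 j *: G j q
  + \sum_(i < mx) \sum_(j < my) (xy.1 0 i * xy.2 0 j) *: H i j q.

Definition g_BMI n l mx my F0 F G H xy (q : 'rV[R]_l) : bool :=
  ~~ `[< posdef (@F_BMI n l mx my F0 F G H xy q) >].

Definition family_BMI n l mx my F0 F G H : set ('rV[R]_l -> bool) :=
  [set @g_BMI n l mx my F0 F G H xy | xy in [set: 'rV[R]_mx * 'rV[R]_my]].

Definition vc_bound (m n : nat) : R :=
  2 * m%:R * (ln (4 * expR 1 * (n%:R ^+ 2)) / ln 2).

End Defs.

(* Main.v *)
Require Import Defs.
From HB Require Import structures.
From mathcomp Require Import all_boot all_order all_algebra.
From mathcomp Require Import all_classical all_reals all_analysis.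
From mathcomp Require Import zify ring lra.
From mathcomp Require polyrcf.
Set Implicit Arguments. Unset Strict Implicit. Unset Printing Implicit Defensive.
Import Order.TTheory GRing.Theory Num.Theory numFieldNormedType.Exports.
Local Open Scope ring_scope.
Local Open Scope classical_set_scope.

(* Positive definiteness of F(., q) is governed by the single polynomial
   f_q = det F(., q), of degree D <= 2n in k = m_theta variables: for d > 0 the
   set {F(., q) > 0, f_q >= d} is closed and {F(., q) > 0, f_q > d} is open, and
   they differ only where f_q = d.  Shattering N points thus yields, for small
   thresholds d_q, 2^N nonempty closed cells.  In a cell choose a maximal set I
   of equations f_q = d_q that still has a solution; for generic thresholds
   #|I| <= k, since k + 1 polynomials in k variables are algebraically dependent.
   Minimising sum_(q in I) (f_q - d_q)^2 + zeta * sum_j x_j^(2D), zeta small,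
   under the remaining constraints gives an interior critical point: on the
   walls outside I the sum of squares is bounded away from 0 by maximality.  For
   each I the critical equations zeta * x_j^(2D-1) + (degree < 2D) = 0 have at
   most (2D-1)^k solutions for all but finitely many zeta, and a critical point
   determines its cell up to the 2^#|I| choices on I.  Hence
     2^N <= (2 (2D-1))^k * sum_(j <= k) C(N, j) <= (6 e n^2 N / k)^k,
   from which N <= 2 k log_2 (4 e n^2) follows. *)

(** * Polynomial functions of bounded total degree *)

Section PolynomialFunctions.
Context {R : realType} {k : nat}.
Implicit Types (f g : 'rV[R]_k -> R) (a b : {ffun 'I_k -> nat}).

Definition mon a (x : 'rV[R]_k) : R := \prod_i x 0 i ^+ a i.

Definition deg a : nat := (\sum_i a i)%N.

(** [d] is only an upper bound for the degree, and [s] may repeat exponents: sums and products of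
    polynomials then come from concatenating and multiplying lists of terms. *)
Definition polyfun (d : nat) f : Prop :=
  exists2 s : seq (R * {ffun 'I_k -> nat}),
    all (fun t => (deg t.2 <= d)%N) s &
    forall x, f x = \sum_(t <- s) t.1 * mon t.2 x.

Definition mi_add a b : {ffun 'I_k -> nat} := [ffun i => (a i + b i)%N].

Lemma deg_add a b : deg (mi_add a b) = (deg a + deg b)%N.
Proof. by rewrite /deg -big_split; apply: eq_bigr => i _; rewrite ffunE. Qed.

Lemma mon_add a b x : mon (mi_add a b) x = mon a x * mon b x.
Proof.
by rewrite /mon -big_split; apply: eq_bigr => i _; rewrite ffunE exprD.
Qed.

Definition mi1 (j : 'I_k) : {ffun 'I_k -> nat} := [ffun i => (i == j) : nat].

Lemma deg_mi1 j : deg (mi1 j) = 1%N.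
Proof.
rewrite /deg (bigD1 j) //= ffunE eqxx big1 ?addn0 // => i /negbTE ij.
by rewrite ffunE ij.
Qed.

Lemma mon_mi1 j x : mon (mi1 j) x = x 0 j.
Proof.
rewrite /mon (bigD1 j) //= ffunE eqxx expr1 big1 ?mulr1 // => i /negbTE ij.
by rewrite ffunE ij expr0.
Qed.

Lemma eq_polyfun d f g : f =1 g -> polyfun d f -> polyfun d g.
Proof. by move=> fg [s sd sf]; exists s => // x; rewrite -fg. Qed.

Lemma polyfun_leq d d' f : (d <= d')%N -> polyfun d f -> polyfun d' f.
Proof.
move=> dd' [s /allP sd sf]; exists s => //; apply/allP => t /sd /leq_trans; exact.
Qed.

Lemma polyfun_mon d (c : R) a : (deg a <= d)%N -> polyfun d (fun x => c * mon a x).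
Proof.
move=> ad; exists [:: (c, a)] => [|x]; first by rewrite /= ad.
by rewrite big_seq1.
Qed.

Lemma polyfun_cst d (c : R) : polyfun d (fun=> c).
Proof.
apply: (@eq_polyfun _ (fun x => c * mon [ffun=> 0%N] x)); last first.
  by apply: polyfun_mon; rewrite /deg big1 // => i _; rewrite ffunE.
by move=> x; rewrite /mon big1 ?mulr1 // => i _; rewrite ffunE expr0.
Qed.

Lemma polyfun_coord j : polyfun 1 (fun x => x 0 j).
Proof.
apply: (@eq_polyfun _ (fun x => 1 * mon (mi1 j) x)).
  by move=> x; rewrite mul1r mon_mi1.
by apply: polyfun_mon; rewrite deg_mi1.
Qed.

Lemma polyfunD d f g : polyfun d f -> polyfun d g -> polyfun d (fun x => f x + g x).
Proof.
move=> [s sd sf] [t td tg]; exists (s ++ t) => [|x]; first by rewrite all_cat sd.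
by rewrite big_cat /= -sf -tg.
Qed.

Lemma polyfunM d e f g :
  polyfun d f -> polyfun e g -> polyfun (d + e) (fun x => f x * g x).
Proof.
move=> [s /allP sd sf] [r /allP td tg].
exists [seq (u.1 * v.1, mi_add u.2 v.2) | u <- s, v <- r] => [|x].
  apply/allP => _ /allpairsP[[u v] /= [us vt ->]] /=.
  by rewrite deg_add leq_add ?sd ?td.
rewrite sf tg big_allpairs_dep mulr_suml; apply: eq_bigr => u _.
by rewrite mulr_sumr; apply: eq_bigr => v _ /=; rewrite mon_add mulrACA.
Qed.

Lemma polyfunZ d c f : polyfun d f -> polyfun d (fun x => c * f x).
Proof. by move=> df; rewrite -[d]add0n; apply: polyfunM => //; exact: polyfun_cst. Qed.

Lemma polyfun_sum d (I : Type) (r : seq I) (P : pred I) (F : I -> 'rV[R]_k -> R) :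
  (forall i, P i -> polyfun d (F i)) -> polyfun d (fun x => \sum_(i <- r | P i) F i x).
Proof.
move=> dF; elim: r => [|i r IH].
  by apply: eq_polyfun (polyfun_cst d 0) => x; rewrite big_nil.
case: (boolP (P i)) => Pi.
  by apply: eq_polyfun (polyfunD (dF i Pi) IH) => x; rewrite big_cons Pi.
by apply: eq_polyfun IH => x; rewrite big_cons (negbTE Pi).
Qed.

Lemma polyfun_prod (I : Type) (r : seq I) (P : pred I) (d : I -> nat)
    (F : I -> 'rV[R]_k -> R) :
  (forall i, P i -> polyfun (d i) (F i)) ->
  polyfun (\sum_(i <- r | P i) d i) (fun x => \prod_(i <- r | P i) F i x).
Proof.
move=> dF; elim: r => [|i r IH].
  by apply: eq_polyfun (polyfun_cst _ 1) => x; rewrite big_nil.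
case: (boolP (P i)) => Pi.
  rewrite big_cons Pi.
  by apply: eq_polyfun (polyfunM (dF i Pi) IH) => x; rewrite big_cons Pi.
rewrite big_cons (negbTE Pi).
by apply: eq_polyfun IH => x; rewrite big_cons (negbTE Pi).
Qed.

Lemma polyfunX d n f : polyfun d f -> polyfun (d * n) (fun x => f x ^+ n).
Proof.
move=> df; elim: n => [|n IH]; first by rewrite muln0; exact: (polyfun_cst _ 1).
by rewrite mulnS; apply: eq_polyfun (polyfunM df IH) => x; rewrite exprS.
Qed.

Lemma polyfun_continuous d f : polyfun d f -> continuous f.
Proof.
move=> [s _ sf]; have -> : f = fun x => \sum_(t <- s) t.1 * mon t.2 x by apply/funext.
apply: continuous_big => [|t _]; first exact: add_continuous.
move=> x; apply: continuousM; first exact: cst_continuous.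
move: x; apply: continuous_big => [|i _ x]; first exact: mul_continuous.
exact: (continuous_comp (@coord_continuous _ _ _ _ _ _) (@exprn_continuous _ _ _)).
Qed.

(** The partial derivative is encoded algebraically: along the line through x in direction j the
    monomial is a univariate polynomial in t, and its coefficient of t is the derivative at x. *)
Lemma mon_deriv a j : exists2 g, polyfun (deg a).-1 g &
  forall x, exists2 p : {poly R},
    forall t, mon a (x + t *: delta_mx 0 j) = p.[t] & p`_1 = g x.
Proof.
pose del := [ffun i => (a i - (i == j))%N] : {ffun 'I_k -> nat}.
exists (fun x => (a j)%:R * mon del x).
  case: (posnP (a j)) => [->|aj].
    by apply: eq_polyfun (polyfun_cst _ 0) => x; rewrite mul0r.
  apply: polyfun_mon; suff -> : a = mi_add del (mi1 j).
    by rewrite deg_add deg_mi1 addn1.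
  apply/ffunP => i; rewrite !ffunE subnK //.
  by case: eqP => [->|].
move=> x; exists ((\prod_(i | i != j) x 0 i ^+ a i) *: ('X + (x 0 j)%:P) ^+ a j).
  move=> t; rewrite /mon (bigD1 j) //= mulrC hornerZ; congr (_ * _).
    apply: eq_bigr => i /negbTE ij.
    by rewrite !mxE ij andbF mulr0 addr0.
  by rewrite horner_exp !hornerE !mxE !eqxx mulr1 addrC.
set p := (_ *: _); have -> : p`_1 = p^`().[0].
  by rewrite horner_coef0 coef_deriv mulr1n.
rewrite /p derivZ deriv_exp derivD derivX derivC addr0 mul1r hornerZ hornerMn.
rewrite horner_exp !hornerE -mulr_natl mulrCA.
congr (_ * _); rewrite [in RHS]/mon [in RHS](bigD1 j) //=.
rewrite ffunE eqxx subn1 mulrC; congr (_ * _).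
by apply: eq_bigr => i /negbTE ij; rewrite ffunE ij subn0.
Qed.

Lemma polyfun_deriv d f j : polyfun d f -> exists2 g, polyfun d.-1 g &
  forall x, exists2 p : {poly R},
    forall t, f (x + t *: delta_mx 0 j) = p.[t] & p`_1 = g x.
Proof.
move=> [s]; elim: s f => [|[c a] s IH] f /=.
  move=> _ sf; exists (fun=> 0) => [|x]; first exact: polyfun_cst.
  by exists 0 => [t|]; rewrite ?sf ?big_nil ?horner0 ?coef0.
move=> /andP[ad sd] sf; have [g dg gP] := IH _ sd (fun x => erefl).
have [h dh hP] := mon_deriv a j.
exists (fun x => c * h x + g x) => [|x].
  apply: polyfunD => //; apply: polyfunZ; apply: polyfun_leq dh.
  by rewrite -!subn1 leq_sub2r.
have [p pE p1] := gP x; have [q qE q1] := hP x.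
exists (c *: q + p) => [t|].
  by have /= pEt := pE t; rewrite sf big_cons /= qE pEt !hornerE.
by rewrite coefD coefZ p1 q1.
Qed.

(** Exponents below L form a finite type, so that monomials can index the rows and columns of
    matrices. *)
Definition mi_of L (a : {ffun 'I_k -> 'I_L}) : {ffun 'I_k -> nat} :=
  [ffun i => a i : nat].

Lemma leq_deg a i : (a i <= deg a)%N.
Proof. by rewrite /deg (bigD1 i) //= leq_addr. Qed.

Lemma mi_ofP L a : (deg a <= L)%N -> exists b : {ffun 'I_k -> 'I_L.+1}, mi_of b = a.
Proof.
move=> aL; exists [ffun i => inord (a i)]; apply/ffunP => i; rewrite !ffunE.
by rewrite inordK // ltnS (leq_trans (leq_deg a i)).
Qed.

Lemma polyfun_coef d L f : (d <= L)%N -> polyfun d f ->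
  exists c : {ffun 'I_k -> 'I_L.+1} -> R,
    forall x, f x = \sum_(a | (deg (mi_of a) <= d)%N) c a * mon (mi_of a) x.
Proof.
move=> dL [s]; elim: s f => [|[c a] s IH] f /=.
  by move=> _ sf; exists (fun=> 0) => x; rewrite sf big_nil big1 // => i _; rewrite mul0r.
move=> /andP[ad sd] sf; have [g gP] := IH _ sd (fun x => erefl).
have [b bE] := mi_ofP (leq_trans ad dL).
exists (fun i => c * (i == b)%:R + g i) => x.
rewrite sf big_cons /= gP; under [RHS]eq_bigr do rewrite mulrDl.
rewrite big_split /=; congr (_ + _); rewrite (bigD1 b) /= ?bE // eqxx mulr1.
by rewrite big1 ?addr0 // => i /andP[_ /negbTE->]; rewrite mulr0 mul0r.
Qed.

End PolynomialFunctions.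

(** * Counting the common zeros of k equations with pure leading powers *)

Section CountingSolutions.
Context {R : realType} {k : nat}.

Lemma sum_enum_val (A : finType) (F : A -> R) :
  \sum_(i < #|A|) F (enum_val i) = \sum_a F a.
Proof.
by rewrite [RHS](reindex (@enum_val _ A)) //; exact/onW_bij/enum_val_bij.
Qed.

Lemma diff_coord (x y : 'rV[R]_k) : x != y -> exists j, x 0 j != y 0 j.
Proof.
move=> xy; apply/existsP; apply: contraNT xy; rewrite negb_exists => /forallP h.
by apply/eqP/rowP => j; apply/eqP; have := h j; rewrite negbK.
Qed.

(** Each of the T other points differs from [z t] in some coordinate, which gives an affine factor
    vanishing there and not at [z t]; f is the product of these factors. *)
Lemma polyfun_separate T (z : 'I_T.+1 -> 'rV[R]_k) t : injective z ->
  exists2 f, polyfun T f & forall s, (f (z s) != 0) = (s == t).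
Proof.
move=> zi.
have /choice[j jP] : forall s, exists g : 'rV[R]_k -> R,
    s != t -> [/\ polyfun 1 g, g (z s) = 0 & g (z t) != 0].
  move=> s; case: (eqVneq s t) => [_|st]; first by exists (fun=> 0).
  have /diff_coord[j zj] : z t != z s by apply: contra_neq st => /zi.
  exists (fun x => x 0 j + - z s 0 j) => _; split; rewrite ?subrr ?subr_eq0 //.
  by apply: polyfunD; [exact: polyfun_coord | exact: polyfun_cst].
exists (fun x => \prod_(s | s != t) j s x).
  have := @polyfun_prod R k _ (index_enum 'I_T.+1) (fun s => s != t) (fun=> 1%N) j.
  rewrite sum1_card cardC1 card_ord; apply => s /jP[] //.
move=> s; case: (eqVneq s t) => [->|st].
  by apply/prodf_neq0 => i /jP[].
apply/negbTE; rewrite negbK; apply/prodf_eq0; exists s => //.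
by have [_ -> _] := jP s st.
Qed.

(** By the separating polynomials, every unit row vector is a combination of rows of monomial values
    at the T + 1 points. Monomials of degree above T contribute zero rows. *)
Lemma mon_interpolation T (z : 'I_T.+1 -> 'rV[R]_k) : injective z ->
  \rank (\matrix_(a < #|{ffun 'I_k -> 'I_T.+1}|, t < T.+1)
    (if (deg (mi_of (enum_val a)) <= T)%N then mon (mi_of (enum_val a)) (z t) else 0))
  = T.+1.
Proof.
move=> zi; set E := \matrix_(a, t) _.
apply/eqP; rewrite -[_ == _]/(row_full E) -sub1mx; apply/row_subP => t.
have [f fT fz] := polyfun_separate t zi.
have [c fc] := polyfun_coef (leqnn T) fT.
suff -> : row t 1%:M = ((f (z t))^-1 *: \row_a c (enum_val a)) *m E by exact: submxMl.
apply/rowP => s; rewrite -scalemxAl !mxE.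
have -> : \sum_a (\row_a0 c (enum_val a0)) 0 a * E a s = f (z s).
  rewrite fc [RHS]big_mkcond -[RHS]sum_enum_val.
  apply: eq_bigr => a _; rewrite !mxE; case: ifP; rewrite ?mulr0 //.
case: eqVneq => [<-|ts]; first by rewrite mulVf // fz.
by have := fz s; rewrite (negbTE (_ : s != t)) ?(eq_sym s) // => /negbFE/eqP ->; rewrite mulr0.
Qed.

(* Off the roots of a characteristic polynomial in zeta, the relations
   zeta * x_j ^ e = - p_j (x) reduce every monomial of bounded degree to the
   e ^ k monomials all of whose exponents are smaller than e, and monomials of
   large enough degree separate the solutions. *)
Lemma few_solutions e (p : 'I_k -> 'rV[R]_k -> R) :
  (forall j, polyfun e (p j)) ->
  exists2 chi : {poly R}, chi != 0 &
    forall zeta, ~~ root chi zeta ->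
    forall T (z : 'I_T -> 'rV[R]_k), injective z ->
      (forall t j, zeta * z t 0 j ^+ e + p j (z t) = 0) -> (T <= e ^ k)%N.
Proof.
move=> pe; pose L := (e ^ k)%N; pose A := {ffun 'I_k -> 'I_L.+1}.
pose big (a : A) j := (e <= a j)%N.
(* If a_j >= e, then mon a = mon a' * x_j ^ e, and the j-th equation turns zeta * mon a into - mon
   a' * p_j, whose degree is again at most deg a <= L; [c] holds the coefficients of mon a' *
   p_j. *)
have /choice[c cP] : forall a : A, exists c : A -> R,
    (deg (mi_of a) <= L)%N -> [exists j, big a j] ->
    forall (x : 'rV[R]_k) zeta, (forall j, zeta * x 0 j ^+ e + p j x = 0) ->
      zeta * mon (mi_of a) x +
      \sum_(b | (deg (mi_of b) <= L)%N) c b * mon (mi_of b) x = 0.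
  move=> a; case: (leqP (deg (mi_of a)) L) => aL; last by exists (fun=> 0).
  case: (boolP [exists j, big a j]) => [/existsP[j aj]|_]; last by exists (fun=> 0).
  pose a' : {ffun 'I_k -> nat} := [ffun i => (a i - (if i == j then e else 0))%N].
  pose ej : {ffun 'I_k -> nat} := [ffun i => if i == j then e else 0%N].
  have aE : mi_of a = mi_add a' ej.
    apply/ffunP => i; rewrite /mi_of /mi_add !ffunE subnK //.
    by case: eqP => [->|].
  have dej : deg ej = e.
    rewrite /deg (bigD1 j) //= ffunE eqxx big1 ?addn0 // => i /negbTE ij.
    by rewrite ffunE ij.
  have mej x : mon ej x = x 0 j ^+ e :> R.
    rewrite /mon (bigD1 j) //= ffunE eqxx big1 ?mulr1 // => i /negbTE ij.
    by rewrite ffunE ij expr0.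
  have : polyfun L (fun x => (1 * mon a' x) * p j x).
    apply: polyfun_leq aL _; rewrite aE deg_add dej; apply: polyfunM => //.
    exact: polyfun_mon.
  move=> /(polyfun_coef (leqnn L))[c cE]; exists c => _ _ x zeta zx.
  by rewrite -cE mul1r aE mon_add mej mulrCA -mulrDr zx mulr0.
pose m := #|A|.
pose B : 'M[R]_m := \matrix_(a, b)
  (if (deg (mi_of (enum_val a)) <= L)%N && (deg (mi_of (enum_val b)) <= L)%N &&
      [exists j, big (enum_val a) j] then c (enum_val a) (enum_val b) else 0).
(* Its roots are the zeta for which zeta + B is singular. *)
exists (char_poly (- B)); first exact/monic_neq0/char_poly_monic.
move=> zeta; rewrite -eigenvalue_root_char => zB T z zi zP.
rewrite leqNgt; apply/negP => TL.
pose y (t : 'I_L.+1) := z (widen_ord TL t).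
have yi : injective y by move=> s t /zi /(congr1 val) /= /val_inj.
have := mon_interpolation yi; set E := \matrix_(a, t) _ => rE.
have uB : zeta%:M + B \in unitmx.
  rewrite -row_free_unit -kermx_eq0; apply: contraNT zB => /rowV0Pn[v vk v0].
  apply/eigenvalueP; exists v => //; apply/eqP; rewrite mulmxN eqr_oppLR -subr_eq0 opprK.
  by rewrite addrC -mul_mx_scalar -mulmxDr (sub_kermxP vk).
pose S : 'M[R]_(#|{ffun 'I_k -> 'I_e}|, L.+1) :=
  \matrix_(b, t) mon (mi_of (enum_val b)) (y t).
(* The left side has the rank L + 1 of [E], since zeta + B is invertible, whereas [S] has only e ^ k
   = L rows. Rows with some exponent at least e vanish by the relations; the others are multiples of
   rows of [S], or zero. *)
suff : ((zeta%:M + B) *m E <= S)%MS.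
  move=> /mxrankS; rewrite eqmxMfull ?row_full_unit // rE => /leq_trans/(_ (rank_leq_row _)).
  by rewrite card_ffun !card_ord ltnn.
apply/row_subP => a; set a0 := enum_val a.
have rowE : row a ((zeta%:M + B) *m E) = \row_t (
    zeta * E a t + \sum_b B a b * E b t).
  by apply/rowP => t; rewrite mulmxDl mul_scalar_mx !mxE.
case: (boolP [exists j, big a0 j]) => [lg|sm].
  rewrite rowE (_ : \row_t _ = 0) ?sub0mx //; apply/rowP => t; rewrite !mxE.
  case: ifP => aL; last first.
    by rewrite mulr0 add0r big1 // => b _; rewrite mxE aL mul0r.
  have /= cE := cP a0 aL lg (y t) zeta (zP _); rewrite -[RHS]cE; congr (_ + _).
  rewrite [RHS]big_mkcond -[RHS]sum_enum_val.
  by apply: eq_bigr => b _; rewrite !mxE aL lg andbT /=; case: ifP; rewrite ?mulr0.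
rewrite rowE (_ : \row_t _ = zeta *: row a E); last first.
  apply/rowP => t; rewrite !mxE [X in _ + X]big1 ?addr0 // => b _.
  by rewrite mxE (negbTE sm) andbF mul0r.
apply: scalemx_sub; rewrite (_ : row a E = if (deg (mi_of a0) <= L)%N
  then \row_t mon (mi_of a0) (y t) else 0); last first.
  by apply/rowP => t; rewrite !mxE; case: ifP; rewrite mxE.
case: ifP => [aL|_]; last exact: sub0mx.
have lt j : (a0 j < e)%N.
  by rewrite ltnNge; apply: contra sm => h; apply/existsP; exists j.
pose b : {ffun 'I_k -> 'I_e} := [ffun j => Ordinal (lt j)].
rewrite (_ : \row_t _ = row (enum_rank b) S) ?row_sub //.
apply/rowP => t; rewrite !mxE enum_rankK; congr (mon _ _).
by apply/ffunP => j; rewrite /mi_of !ffunE.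
Qed.

End CountingSolutions.

(** * Uniqueness of base B expansions *)

Lemma digits_inj B N (u v : nat -> nat) :
  (forall i, u i < B)%N -> (forall i, v i < B)%N ->
  (\sum_(i < N) u i * B ^ i = \sum_(i < N) v i * B ^ i)%N ->
  forall i, (i < N)%N -> u i = v i.
Proof.
elim: N u v => // N IH u v uB vB; rewrite !big_ord_recl !expn0 !muln1.
have shift w : (\sum_(i < N) w (bump 0 i) * B ^ bump 0 i =
    B * \sum_(i < N) w i.+1 * B ^ i)%N.
  by rewrite big_distrr; apply: eq_bigr => i _; rewrite /bump add1n expnS mulnCA.
rewrite (shift u) (shift v) => uv.
have uv0 : u 0%N = v 0%N.
  by have := congr1 (modn^~ B) uv; rewrite ![(_ + B * _)%N]addnC ![(B * _)%N]mulnC !modnMDl !modn_small.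
case=> [//|i] iN; apply: (IH (fun i => u i.+1) (fun i => v i.+1)) => //.
move: uv; rewrite uv0 => /addnI/eqP; rewrite eqn_pmul2l ?(leq_ltn_trans _ (uB 0%N)) //.
by move/eqP.
Qed.

(** The sum is a base B expansion with digit [a i] at position [h i] and 0 at all other positions;
    [u] is this digit sequence. *)
Lemma sparse_digits_inj B N m (h : 'I_m -> 'I_N) : injective h ->
  injective (fun a : {ffun 'I_m -> 'I_B} => \sum_i a i * B ^ h i)%N.
Proof.
move=> hi a b /= ab.
pose u (a : {ffun 'I_m -> 'I_B}) j := (\sum_(i | h i == j :> nat) a i)%N.
have uh c i : u c (h i) = c i.
  by rewrite /u (bigD1 i) //= big1 ?addn0 // => l /andP[/eqP/val_inj/hi -> /eqP].
have uB (c : {ffun 'I_m -> 'I_B}) j : (0 < m)%N -> (u c j < B)%N.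
  move=> m0; case: (pickP (fun i => h i == j :> nat)) => [i /eqP <-|no].
    by rewrite uh.
  by rewrite /u big_pred0 // (leq_ltn_trans _ (ltn_ord (c (Ordinal m0)))).
have uE (c : {ffun 'I_m -> 'I_B}) : (\sum_i c i * B ^ h i = \sum_(j < N) u c j * B ^ j)%N.
  transitivity (\sum_i \sum_(j < N | h i == j) c i * B ^ j)%N.
    by apply: eq_bigr => i _; rewrite (big_pred1 (h i)) // => j; rewrite eq_sym.
  rewrite (exchange_big_dep xpredT) //=; apply: eq_bigr => j _.
  by rewrite /u big_distrl.
apply/ffunP => i; apply/val_inj => /=; rewrite -(uh a) -(uh b).
have m0 : (0 < m)%N by apply: leq_ltn_trans (ltn_ord i).
by apply: (@digits_inj B N) => // [j|j|]; rewrite ?uB // -!uE.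
Qed.

(** * Algebraic dependence and the choice of generic thresholds *)

Section GenericThresholds.
Context {R : realType} {k : nat}.

(** A dimension count: the (C + 1) ^ (k + 1) products with exponents at most C lie in the span of at
    most (L + 1) ^ k monomials, L = D (k + 1) C. The choice of C gives (L + 1) ^ k <= C (C + 1) ^ k
    < (C + 1) ^ (k + 1), so the coefficient matrix has a nonzero left kernel vector. *)
Lemma algebraic_dependence D (f : 'I_k.+1 -> 'rV[R]_k -> R) :
  (forall i, polyfun D (f i)) ->
  exists2 c : {ffun 'I_k.+1 -> 'I_((D * k.+1).+1 ^ k).+1} -> R,
    exists a, c a != 0 & forall x, \sum_a c a * \prod_i f i x ^+ a i = 0.
Proof.
move=> fD; set C := ((D * k.+1).+1 ^ k)%N; pose L := (D * k.+1 * C)%N.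
have /choice[c cP] (a : {ffun 'I_k.+1 -> 'I_C.+1}) :
    exists c : {ffun 'I_k -> 'I_L.+1} -> R, forall x,
    \prod_i f i x ^+ a i = \sum_(b | (deg (mi_of b) <= L)%N) c b * mon (mi_of b) x.
  apply: polyfun_coef (leqnn L) _.
  apply: (@polyfun_leq _ _ (\sum_i D * a i)%N).
    rewrite -big_distrr /L -mulnA leq_mul2l; apply/orP; right.
    rewrite -[X in (_ <= X * _)%N](card_ord k.+1) -sum_nat_const.
    by apply: leq_sum => i _; rewrite -ltnS.
  by apply: polyfun_prod => i _; exact: polyfunX.
pose M : 'M[R]_(#|{ffun 'I_k.+1 -> 'I_C.+1}|, #|{ffun 'I_k -> 'I_L.+1}|) :=
  \matrix_(a, b) c (enum_val a) (enum_val b).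
have : kermx M != 0.
  rewrite kermx_eq0 /row_free; apply/eqP => rM.
  have := rank_leq_col M; rewrite rM !card_ffun !card_ord leqNgt => /negP; apply.
  apply: (@leq_ltn_trans (((D * k.+1).+1 * C.+1) ^ k))%N.
    have leq_exp j m n : (m <= n -> m ^ j <= n ^ j)%N by case: j => // j; rewrite leq_exp2r.
    by apply: leq_exp; rewrite /L; nia.
  rewrite expnMn -/C expnSr mulnC ltn_pmul2l ?expn_gt0 //.
move=> /rowV0Pn[v /sub_kermxP vM v0].
have [a va] : exists a, v 0 a != 0.
  apply/existsP; apply: contraNT v0; rewrite negb_exists => /forallP h.
  by apply/eqP/rowP => j; rewrite mxE; apply/eqP; have := h j; rewrite negbK.
exists (fun a => v 0 (enum_rank a)); first by exists (enum_val a); rewrite enum_valK.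
move=> x; under eq_bigr do rewrite cP big_distrr /=.
rewrite exchange_big /= big1 // => b _.
under eq_bigr do rewrite mulrA; rewrite -mulr_suml.
suff -> : \sum_a0 v 0 (enum_rank a0) * c a0 b = 0 by rewrite mul0r.
have := congr1 (fun w : 'rV[R]_#|{ffun 'I_k -> 'I_L.+1}| => w 0 (enum_rank b)) vM.
rewrite !mxE => vMb; rewrite -[RHS]vMb -[LHS]sum_enum_val; apply: eq_bigr => i _.
by rewrite mxE enum_valK enum_rankK.
Qed.

(* Substituting distinct powers s ^ (B ^ i) for the thresholds turns an
   algebraic relation into a nonzero univariate polynomial in s. *)
Lemma generic_thresholds N D (f : 'I_N -> 'rV[R]_k -> R) :
  (forall i, polyfun D (f i)) ->
  exists2 B, (0 < B)%N & exists2 chi : {poly R}, chi != 0 &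
    forall s, ~~ root chi s -> forall (I : {set 'I_N}) x,
      (forall i, i \in I -> f i x = s ^+ (B ^ i)) -> (#|I| <= k)%N.
Proof.
move=> fD; pose B := ((D * k.+1).+1 ^ k).+1; exists B => //.
have /choice[c cP] (h : {ffun 'I_k.+1 -> 'I_N}) :
    exists c : {ffun 'I_k.+1 -> 'I_B} -> R, (exists a, c a != 0) /\
    forall x, \sum_a c a * \prod_i f (h i) x ^+ a i = 0.
  by have [c] := algebraic_dependence (fun i => fD (h i)); exists c.
(* The relation among the functions selected by [h], with the thresholds substituted. For injective
   [h], distinct exponent vectors give distinct powers of s, so no cancellation occurs and [q h] is
   nonzero. *)
pose q (h : {ffun 'I_k.+1 -> 'I_N}) :=
  \sum_a c h a *: 'X^(\sum_i a i * B ^ h i)%N : {poly R}.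
exists (\prod_(h : {ffun 'I_k.+1 -> 'I_N} | injectiveb h) q h).
  apply/prodf_neq0 => h /injectiveP hi; have [[a ca] _] := cP h.
  apply: contra_neq ca => /(congr1 (fun p : {poly R} => p`_(\sum_i a i * B ^ h i)%N)).
  rewrite coef0 coef_sum (bigD1 a) //= coefZ coefXn eqxx mulr1 big1 ?addr0 // => b ba.
  rewrite coefZ coefXn; case: eqP => [/(sparse_digits_inj hi) ab|_]; last by rewrite mulr0.
  by rewrite ab eqxx in ba.
(* With more than k equations solved at x, let [h] enumerate k + 1 of them: the relation evaluated
   at x says that s is a root of [q h]. *)
move=> s sr I x fI; rewrite leqNgt; apply/negP => Ik; move/negP: sr; apply.
pose h : {ffun 'I_k.+1 -> 'I_N} := [ffun i => enum_val (widen_ord Ik i)].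
have hi : injective h.
  by move=> i j; rewrite !ffunE => /enum_val_inj/(congr1 val)/= /val_inj.
rewrite /root horner_prod; apply/prodf_eq0; exists h; first exact/injectiveP.
have [_ /(_ x) hx] := cP h; apply/eqP; rewrite /q horner_sum -[RHS]hx.
apply: eq_bigr => a _; rewrite hornerZ hornerXn; congr (_ * _).
rewrite expr_sum; apply: eq_bigr => i _.
by rewrite fI ?ffunE ?enum_valP // -exprM mulnC.
Qed.

Lemma small_nonroot (p : {poly R}) (eps : R) : p != 0 -> 0 < eps ->
  exists s, [/\ 0 < s, s < eps & ~~ root p s].
Proof.
(* These are [size p] distinct points of the interval from 0 to eps, more than p has roots. *)
move=> p0 eps0; pose r := [seq eps / i.+2%:R | i <- iota 0 (size p)].
have : ~~ all (root p) r.
  apply/negP => /(max_poly_roots p0); rewrite size_map size_iota ltnn => /implyP.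
  rewrite implybF map_inj_uniq ?iota_uniq // => i j /(mulfI (lt0r_neq0 eps0)).
  by move=> /invr_inj/eqP; rewrite eqr_nat => /eqP[].
rewrite -has_predC => /hasP[_ /mapP[i _ ->] ns]; exists (eps / i.+2%:R); split => //.
  by rewrite divr_gt0.
by rewrite ltr_pdivrMr // ltr_pMr // ltr1n.
Qed.

End GenericThresholds.

(** * Penalised minimisation and the equations of its critical points *)

Lemma horner_local_min {R : realType} (p : {poly R}) (eps : R) : 0 < eps ->
  (forall t, `|t| < eps -> p.[0] <= p.[t]) -> p`_1 = 0.
Proof.
move=> eps0 pmin.
have in0 : (0 : R) \in `](- eps), eps[%R by rewrite in_itv /= oppr_lt0 eps0.
have h : is_derive (0 : R) 1 (horner p) 0.
  apply: (@derive1_at_min _ _ (- eps) eps) => //.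
  - by rewrite ge0_cp // ltW.
  - by move=> t; rewrite in_itv /= -ltr_norml => /pmin.
have -> : p`_1 = p^`().[0] by rewrite horner_coef0 coef_deriv mulr1n.
by rewrite derivE derive1E derive_val.
Qed.

Section CriticalPoints.
Context {R : realType} {k : nat}.
Implicit Types (P : 'rV[R]_k -> R) (K Z : set 'rV[R]_k).

(** Used with exponent 2D, D > 0: it is then non-negative and large outside boxes, and its j-th
    partial derivative is the pure power 2D * x_j ^ (2D - 1), the leading term in
    [few_solutions]. *)
Definition penalty e (x : 'rV[R]_k) : R := \sum_j x 0 j ^+ e.

Lemma polyfun_penalty e : polyfun e (penalty e).
Proof.
apply: polyfun_sum => j _; rewrite -[X in polyfun X]mul1n.
by apply: polyfunX; exact: polyfun_coord.
Qed.

Lemma penalty_ge0 D (x : 'rV[R]_k) : 0 <= penalty D.*2 x.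
Proof. by apply: sumr_ge0 => j _; rewrite exprn_even_ge0 // odd_double. Qed.

Lemma penalty_gt D (r : R) (x : 'rV[R]_k) j : (0 < D)%N -> 1 <= r -> r < `|x 0 j| ->
  r < penalty D.*2 x.
Proof.
move=> D0 r1 rx; apply: (@lt_le_trans _ _ (x 0 j ^+ D.*2)).
  have ev : ~~ odd D.*2 by rewrite odd_double.
  rewrite -[_ ^+ _](normr_idP _) ?exprn_even_ge0 // normrX.
  apply: (lt_le_trans rx); apply: ler_eXnr; rewrite ?double_gt0 //.
  exact: (le_trans r1 (ltW rx)).
rewrite /penalty (bigD1 j) //= lerDl; apply: sumr_ge0 => i _.
by rewrite exprn_even_ge0 // odd_double.
Qed.

(** The penalty confines the minimisation to a compact box, on which P is at least some c > 0 along
    Z. Since P vanishes at x0, the minimum is at most zeta * S x0, which is below c for small zeta;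
    hence the minimiser avoids Z. *)
Lemma penalized_minimum D P K Z : (0 < D)%N -> continuous P ->
  (forall x, 0 <= P x) -> closed K -> closed Z ->
  (exists2 x0, K x0 & P x0 = 0) -> (forall x, K x -> Z x -> 0 < P x) ->
  exists2 zeta0, 0 < zeta0 & forall zeta, 0 < zeta -> zeta < zeta0 ->
    exists z, [/\ K z, ~ Z z & forall x, K x ->
      P z + zeta * penalty D.*2 z <= P x + zeta * penalty D.*2 x].
Proof.
move=> D0 Pc P0 Kc Zc [x0 Kx0 Px0] KZP.
set S := penalty D.*2; have S0 : 0 <= S x0 := penalty_ge0 _ _.
(* Outside the box of this radius the penalty alone already exceeds its value at x0. *)
pose r := 1 + S x0; have r1 : 1 <= r by rewrite lerDl.
pose box : set 'rV[R]_k := [set x | forall j, `[- r, r]%classic (x ord0 j)].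
have boxc : compact box by apply: (@rV_compact _ _ (fun=> `[- r, r]%classic)) => j; exact: segment_compact.
have outbox x : ~ box x -> r < S x.
  move=> /existsNP[j] /negP; rewrite in_itv /= -ler_norml -ltNge.
  exact: penalty_gt.
have x0box : box x0.
  by apply: contrapT => /outbox; rewrite /r -subr_gt0 opprD addrCA subrr addr0 oppr_gt0 ltr10.
have Kb : compact (K `&` box) by rewrite setIC; exact: compact_closedI.
have [c c0 cP] : exists2 c, 0 < c & forall x, K x -> Z x -> box x -> c <= P x.
  have KZb : compact (K `&` box `&` Z) by exact: compact_closedI.
  have [ne|/set0P/negP/negPn/eqP em] := pselect ((K `&` box `&` Z) !=set0).
    have /= [] := EVT_min_rV ne KZb (continuous_subspaceT Pc).
    move=> w; rewrite inE => -[[Kw bw] Zw] wmin; exists (P w); first exact: KZP.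
    by move=> x Kx Zx bx; apply: wmin; rewrite inE.
  (* Nothing of Z meets K in the box, so any positive c serves. *)
  exists 1 => // x Kx Zx bx.
  by have : (K `&` box `&` Z) x by []; rewrite em.
exists (c / (S x0 + 1)); first by rewrite divr_gt0 // ltr_wpDl.
move=> zeta z0 zc; pose Phi x := P x + zeta * S x.
have Phic : continuous Phi.
  move=> x; apply: (@continuousD _ _ _ P (fun x => zeta * S x)); first exact: Pc.
  apply: (@continuousM _ _ (fun=> zeta) S); first exact: cst_continuous.
  exact: polyfun_continuous (polyfun_penalty _) _.
have ne : (K `&` box) !=set0 by exists x0.
have [z] := EVT_min_rV ne Kb (continuous_subspaceT Phic).
rewrite inE => -[Kz bz] zmin.
have zx0 : Phi z <= zeta * S x0.
  by rewrite -[X in _ <= X]add0r -Px0; apply: zmin; rewrite inE.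
exists z; split => //.
  move=> Zz; have := cP z Kz Zz bz; apply/negP; rewrite -ltNge.
  apply: (@le_lt_trans _ _ (Phi z)).
    by rewrite lerDl mulr_ge0 ?penalty_ge0 // ltW.
  apply: le_lt_trans zx0 _; apply: (@le_lt_trans _ _ (zeta * (S x0 + 1))).
    by rewrite ler_pM2l // lerDl.
  by rewrite -ltr_pdivlMr // ltr_wpDl.
move=> x Kx; have [bx|/outbox Sx] := pselect (box x); first by apply: zmin; rewrite inE.
apply: le_trans zx0 _; apply: (@le_trans _ _ (zeta * S x)); last by rewrite lerDr.
rewrite ler_pM2l // ltW // (le_lt_trans _ Sx) //.
by rewrite lerDr.
Qed.

(** At an interior minimum every partial derivative of P + zeta * penalty vanishes; division by 2D
    leaves the leading coefficient zeta. The functions g depend on P alone, neither on zeta nor on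
    the minimum. *)
Lemma critical_equations D P : (0 < D)%N -> polyfun D.*2 P ->
  exists2 g : 'I_k -> 'rV[R]_k -> R, forall j, polyfun D.*2.-1 (g j) &
    forall (V : set 'rV[R]_k) zeta z, open V -> V z ->
      (forall x, V x -> P z + zeta * penalty D.*2 z <= P x + zeta * penalty D.*2 x) ->
      forall j, zeta * z 0 j ^+ D.*2.-1 + g j z = 0.
Proof.
move=> D0 Pd.
have /choice[g gP] (j : 'I_k) : exists g, polyfun D.*2.-1 g /\
    forall x, exists2 p : {poly R},
    forall t, P (x + t *: delta_mx 0 j) = p.[t] & p`_1 = g x.
  by have [g] := polyfun_deriv j Pd; exists g.
have D20 : (D.*2)%:R != 0 :> R by rewrite pnatr_eq0 double_eq0 -lt0n.
exists (fun j x => (D.*2)%:R^-1 * g j x) => [j|V zeta z Vo Vz zmin j].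
  by apply: polyfunZ; have [] := gP j.
have [_ /(_ z)[p pE <-]] := gP j.
pose q : {poly R} := (\sum_(i | i != j) z 0 i ^+ D.*2)%:P + ('X + (z 0 j)%:P) ^+ D.*2.
have qE t : penalty D.*2 (z + t *: delta_mx 0 j) = q.[t].
  rewrite /penalty (bigD1 j) //= addrC /q !hornerE; congr (_ + _).
    by apply: eq_bigr => i /negbTE ij; rewrite !mxE ij andbF mulr0 addr0.
  by rewrite !mxE !eqxx mulr1 addrC.
have q1 : q`_1 = (D.*2)%:R * z 0 j ^+ D.*2.-1.
  have -> : q`_1 = q^`().[0] by rewrite horner_coef0 coef_deriv mulr1n.
  rewrite /q derivD derivC add0r deriv_exp derivD derivX derivC addr0 mul1r.
  by rewrite hornerMn horner_exp !hornerE mulr_natl.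
have lc : {for (0 : R), continuous (fun t : R => z + t *: delta_mx 0 j : 'rV[R]_k)}.
  apply: continuousD; first exact: cst_continuous.
  exact: scalel_continuous.
have : \forall t \near (0 : R), V (z + t *: delta_mx 0 j).
  by apply: lc; rewrite scale0r addr0; exact: open_nbhs_nbhs.
move=> /nbhs_ballP[eps /= eps0 epsV].
have : (p + zeta *: q)`_1 = 0.
  apply: (horner_local_min eps0) => t te.
  rewrite !hornerD !hornerZ -!pE -!qE scale0r addr0; apply: zmin; apply: epsV.
  by rewrite /ball /= sub0r normrN.
rewrite coefD coefZ q1 => h; apply: (mulfI D20).
by rewrite mulr0 mulrDr mulVKf // -[RHS]h mulrCA addrC.
Qed.

End CriticalPoints.

(** * Critical points of cells and the resulting bound on shattered sets *)

Lemma finite_pos_lb {R : realType} (T : finType) (P : pred T) (F : T -> R) :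
  (forall t, P t -> 0 < F t) -> exists2 eta, 0 < eta & forall t, P t -> eta <= F t.
Proof.
move=> F0; exists (\big[Num.min/1]_(t | P t) F t).
  by apply/bigmin_gtP; split.
by move=> t Pt; apply: bigmin_le_cond.
Qed.

Section PatternCount.
Context {R : realType} {k : nat}.

(* I S is a maximal set of equations f_i = d_i solvable in the closed cell of S,
   and z S is a critical point of a function that depends on I S only. *)
Lemma critical_point_of_cell N D (f : 'I_N -> 'rV[R]_k -> R) (U : 'I_N -> set 'rV[R]_k) :
  (0 < D)%N -> (forall i, polyfun D (f i)) ->
  (forall i x, U i x -> 0 < f i x) ->
  (forall i d, 0 < d -> closed [set x | U i x /\ d <= f i x]) ->
  (forall i d, 0 < d -> open [set x | U i x /\ d < f i x]) ->
  (forall S : {set 'I_N}, exists x, forall i, U i x <-> i \in S) ->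
  exists (I : {set 'I_N} -> {set 'I_N}) (z : {set 'I_N} -> 'rV[R]_k),
    [/\ forall S, (#|I S| <= k)%N,
        forall S S', I S = I S' -> S :&: I S = S' :&: I S' -> z S = z S' -> S = S' &
        forall J (T : nat) (s : 'I_T -> {set 'I_N}),
          injective (z \o s) -> (forall t, I (s t) = J) -> (T <= D.*2.-1 ^ k)%N].
Proof.
move=> D0 fD Upos Uclosed Uopen /choice[x0 x0P].
(* Thresholds up to [eta] keep every witness [x0 S] in the closed cell of S. *)
have [eta eta0 etaP] : exists2 eta, 0 < eta & forall t : {set 'I_N} * 'I_N,
    t.2 \in t.1 -> eta <= f t.2 (x0 t.1).
  by apply: finite_pos_lb => t tS; apply: Upos; exact/x0P.
have [B B0 [chi chi0 chiP]] := generic_thresholds fD.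
have m0 : 0 < Num.min eta 1 by rewrite lt_min eta0 ltr01.
have [s [s0 sm /chiP gen]] := small_nonroot chi0 m0.
have [s_eta s1] : s < eta /\ s < 1 by apply/andP; rewrite -lt_min.
pose d (i : 'I_N) := s ^+ (B ^ i).
have d0 i : 0 < d i by exact: exprn_gt0.
have d_eta i : d i <= eta.
  apply: le_trans (ltW s_eta); apply: ler_iXnr; rewrite ?(ltW s0) ?(ltW s1) //.
  by rewrite expn_gt0 B0.
(* Closed and open forms of membership in U i (b true) or non-membership (b false) at threshold d i;
   they differ only on the wall f i = d i. *)
pose C i (b : bool) : set 'rV[R]_k := if b then [set x | U i x /\ d i <= f i x]
  else ~` [set x | U i x /\ d i < f i x].
pose O i (b : bool) : set 'rV[R]_k := if b then [set x | U i x /\ d i < f i x]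
  else ~` [set x | U i x /\ d i <= f i x].
have Cc i b : closed (C i b).
  by case: b; [exact: Uclosed | apply: open_closedC; exact: Uopen].
have Oo i b : open (O i b).
  by case: b; [exact: Uopen | apply: closed_openC; exact: Uclosed].
have CO i b x : C i b x -> f i x <> d i -> O i b x.
  case: b => /= [[Ux dx] fd|nC fd [Ux dx]].
    by split=> //; rewrite lt_neqAle dx eq_sym; move/eqP: fd => ->.
  by apply: nC; split=> //; rewrite lt_neqAle dx eq_sym; move/eqP: fd => ->.
have OC i b x : O i b x -> C i b x.
  case: b => /=; first by case=> Ux /ltW dx; split.
  by move=> nC; case=> Ux /ltW dx; apply: nC; split.
have Oinj i b b' x : O i b x -> O i b' x -> b = b'.
  case: b; case: b' => //=; first by case=> Ux /ltW dx; case.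
  by move=> h; case=> Ux /ltW dx; case: h.
pose W (S I : {set 'I_N}) x :=
  (forall i, i \in I -> f i x = d i) /\ (forall i, i \notin I -> C i (i \in S) x).
have /choice[I IP] (S : {set 'I_N}) : exists I : {set 'I_N},
    (exists x, W S I x) /\ forall i, i \notin I -> forall x, ~ W S (i |: I) x.
  (* The empty set of equations is solvable by [x0 S], so a solvable set of largest cardinality
     exists. *)
  pose WS (I : {set 'I_N}) := `[< exists x, W S I x >].
  have W0 : WS finset.set0.
    apply/asboolP; exists (x0 S); split=> [i|i _]; first by rewrite inE.
    rewrite /C; case: ifPn => iS /=; last by move=> [/x0P]; rewrite (negbTE iS).
    by split; [exact/x0P | exact: le_trans (d_eta i) (etaP (S, i) iS)].
  case: (@arg_maxnP _ _ WS (fun I : {set 'I_N} => #|I|) W0) => I /asboolP WI Imax.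
  exists I; split => // i iI x Wx.
  have /Imax : WS (i |: I) by apply/asboolP; exists x.
  by rewrite cardsU1 iI /= add1n ltnn.
have Ik S : (#|I S| <= k)%N.
  by have [[x [Ix _]] _] := IP S; apply: gen Ix.
(* This depends on the set J alone, so all cells with the same [I S] share the critical equations
   and the exceptional polynomial [chiJ]. *)
pose P (J : {set 'I_N}) x := \sum_(i in J) (f i x + - d i) ^+ 2.
have PD J : polyfun D.*2 (P J).
  apply: polyfun_sum => i _; rewrite -muln2; apply: polyfunX.
  by apply: polyfunD => //; exact: polyfun_cst.
have P0 J x : 0 <= P J x by apply: sumr_ge0 => i _; exact: sqr_ge0.
have P00 J x : P J x = 0 -> forall i, i \in J -> f i x = d i.
  move=> /eqP; rewrite psumr_eq0 => [/allP h i iJ|i _]; last exact: sqr_ge0.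
  by have := h i (mem_index_enum _); rewrite iJ sqrf_eq0 subr_eq0 => /eqP.
have /choice[g gP] J : exists g : 'I_k -> 'rV[R]_k -> R,
    (forall j, polyfun D.*2.-1 (g j)) /\
    forall (V : set 'rV[R]_k) zeta z, open V -> V z -> (forall x, V x ->
      P J z + zeta * penalty D.*2 z <= P J x + zeta * penalty D.*2 x) ->
    forall j, zeta * z 0 j ^+ D.*2.-1 + g j z = 0.
  by have [h] := critical_equations D0 (PD J); exists h.
have /choice[chiJ chiJP] J : exists chi : {poly R}, chi != 0 /\
    forall zeta, ~~ root chi zeta -> forall T (z : 'I_T -> 'rV[R]_k), injective z ->
      (forall t j, zeta * z t 0 j ^+ D.*2.-1 + g J j (z t) = 0) -> (T <= D.*2.-1 ^ k)%N.
  by have [h] := few_solutions (gP J).1; exists h.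
(* [K S] keeps the closed conditions outside [I S], [Z S] is the union of the walls outside [I S],
   and [V S], the open form of [K S], contains [K S] minus [Z S]. *)
pose K S : set 'rV[R]_k := [set x | forall i, i \notin I S -> C i (i \in S) x].
pose Z S : set 'rV[R]_k := [set x | \prod_(i | i \notin I S) (f i x + - d i) = 0].
pose V S : set 'rV[R]_k := [set x | forall i, i \notin I S -> O i (i \in S) x].
have Kc S : closed (K S).
  rewrite (_ : K S = \bigcap_(i in [set i | i \notin I S]) C i (i \in S)) //.
  exact: closed_bigI.
have Zc S : closed (Z S).
  apply: (@closed_comp _ _ _ [set x | x = 0]); last exact: closed_eq.
  move=> x _; apply: (@polyfun_continuous _ _ (\sum_(i | i \notin I S) D)%N).
  apply: polyfun_prod => i _.
  by apply: polyfunD => //; exact: polyfun_cst.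
have Vo S : open (V S).
  rewrite openE => x Vx; rewrite /interior.
  apply: (@filter_forall _ _ (fun i y => i \notin I S -> O i (i \in S) y) (nbhs x)).
  move=> i; case: (boolP (i \in I S)) => iI; first exact: nearW.
  apply: (filterS _ (open_nbhs_nbhs (conj (Oo i (i \in S)) (Vx i iI)))) => y Oy _.
  exact: Oy.
have KZV S x : K S x -> ~ Z S x -> V S x.
  move=> Kx Zx i iI; apply: CO; first exact: Kx.
  move=> fd; apply: Zx; apply/eqP/prodf_eq0; exists i => //.
  by rewrite fd subrr.
have VK S x : V S x -> K S x by move=> Vx i iI; apply: OC; exact: Vx.
(* A zero of the sum of squares on the wall of some i outside [I S] would solve the equations of
   [i |: I S], against maximality. *)
have KZP S x : K S x -> Z S x -> 0 < P (I S) x.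
  move=> Kx /eqP/prodf_eq0[i iI]; rewrite subr_eq0 => /eqP fd.
  rewrite lt_neqAle P0 andbT eq_sym; apply/eqP => /P00 PIx.
  have [_ /(_ i iI x)] := IP S; apply; split => j; rewrite !inE.
    by case/orP => [/eqP ->//|/PIx].
  by rewrite negb_or => /andP[_ /Kx].
have /choice[zeta0 zeta0P] S : exists zeta0 : R, 0 < zeta0 /\
    forall zeta, 0 < zeta -> zeta < zeta0 ->
    exists z, [/\ K S z, ~ Z S z & forall x, K S x ->
      P (I S) z + zeta * penalty D.*2 z <= P (I S) x + zeta * penalty D.*2 x].
  have [|z0 z00 z0P] := @penalized_minimum _ _ D (P (I S)) (K S) (Z S) D0
      (polyfun_continuous (PD _)) (P0 _) (Kc S) (Zc S) _ (@KZP S).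
  - have [[x [Ix Cx]] _] := IP S; exists x => //.
    by rewrite /P big1 // => i /Ix ->; rewrite subrr expr0n.
  - by exists z0.
have [zmin zmin0 zminP] : exists2 eta, 0 < eta & forall S : {set 'I_N}, true -> eta <= zeta0 S.
  by apply: finite_pos_lb => S _; have [] := zeta0P S.
(* One zeta serves all cells: below every [zeta0 S] and off the roots of every [chiJ J]. *)
have chis0 : \prod_(J : {set 'I_N}) chiJ J != 0.
  by apply/prodf_neq0 => J _; have [] := chiJP J.
have [zeta [zt0 ztm ztr]] := small_nonroot chis0 zmin0.
have /choice[z zP] S := (zeta0P S).2 zeta zt0 (lt_le_trans ztm (zminP S isT)).
have zV S : V S (z S) by have [Kz Zz _] := zP S; exact: KZV.
exists I, z; split=> // [S S' II SI zz|J T t tinj tJ].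
  (* On the common set I the two cells agree by assumption; outside it the same point satisfies the
     open conditions of both, and these are mutually exclusive. *)
  apply/setP => i; have [iI|iI] := boolP (i \in I S).
    by have := congr1 (fun X : {set 'I_N} => i \in X) SI; rewrite !inE -II iI !andbT.
  apply: Oinj (zV S i iI) _; rewrite zz; apply: zV; by rewrite -II.
apply: ((chiJP J).2 zeta _ T (z \o t)) => // [|l].
  apply: contra ztr => rJ; rewrite /root horner_prod; apply/prodf_eq0; exists J => //.
apply: ((gP J).2 (V (t l))) => // x /VK Kx /=.
by have [_ _] := zP (t l); rewrite tJ; apply.
Qed.

(** Sort the 2 ^ N cells by the pair of [I S] and its intersection with S. Within a class the
    critical points are distinct, so it has at most (2D - 1) ^ k cells; each set of at most k
    equations has at most 2 ^ k subsets. *)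
Lemma shatter_card_bound N D (f : 'I_N -> 'rV[R]_k -> R) (U : 'I_N -> set 'rV[R]_k) :
  (0 < D)%N -> (forall i, polyfun D (f i)) ->
  (forall i x, U i x -> 0 < f i x) ->
  (forall i d, 0 < d -> closed [set x | U i x /\ d <= f i x]) ->
  (forall i d, 0 < d -> open [set x | U i x /\ d < f i x]) ->
  (forall S : {set 'I_N}, exists x, forall i, U i x <-> i \in S) ->
  (2 ^ N <= (2 * D.*2.-1) ^ k * \sum_(j < k.+1) 'C(N, j))%N.
Proof.
move=> D0 fD Upos Uclosed Uopen shat.
have [I [z [Ik Iinj few]]] := critical_point_of_cell D0 fD Upos Uclosed Uopen shat.
pose Q (p : {set 'I_N} * {set 'I_N}) := (#|p.1| <= k)%N && (p.2 \subset p.1).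
have -> : (2 ^ N = \sum_(S : {set 'I_N}) 1)%N.
  by rewrite sum1_card -cardsT -powersetT card_powerset cardsT card_ord.
rewrite (partition_big (fun S => (I S, S :&: I S)) Q) /=; last first.
  by move=> S _; rewrite /Q /= Ik subsetIr.
apply: (@leq_trans (\sum_(p | Q p) D.*2.-1 ^ k)%N).
  apply: leq_sum => -[J S0] _; rewrite sum1_card.
  set A := (X in #|X|).
  have AP (t : 'I_#|A|) : I (enum_val t) = J /\ enum_val t :&: J = S0.
    by have := enum_valP t; rewrite unfold_in => /andP[/eqP /= tI /eqP /=]; rewrite tI.
  apply: (few J _ (fun t : 'I_#|A| => enum_val t)).
    move=> t u /= ztu; apply: enum_val_inj.
    have [tI tS] := AP t; have [uI uS] := AP u.
    by apply: Iinj => //; rewrite ?tI ?uI ?tS // -tI tS -uI uS.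
  by move=> t; have [] := AP t.
rewrite -(pair_big_dep (fun J : {set 'I_N} => #|J| <= k)%N
  (fun J S0 : {set 'I_N} => S0 \subset J) (fun _ _ => D.*2.-1 ^ k)%N) /=.
apply: (@leq_trans (\sum_(J : {set 'I_N} | #|J| <= k) 2 ^ k * D.*2.-1 ^ k)%N).
  apply: leq_sum => J Jk; rewrite sum_nat_const leq_mul2r.
  rewrite (eq_card (_ : _ =i powerset J)) => [|S0]; last by rewrite inE.
  by rewrite card_powerset leq_exp2l // Jk orbT.
rewrite sum_nat_const expnMn mulnC leq_mul2l; apply/orP; right.
rewrite -sum1_card (partition_big (fun J : {set 'I_N} => inord #|J| : 'I_k.+1) xpredT) //=.
apply: leq_sum => j _; rewrite sum1_card.
have -> : 'C(N, j) = #|[set J : {set 'I_N} | #|J| == j]%SET|.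
  by rewrite card_draws card_ord.
apply: subset_leq_card; apply/fintype.subsetP => J; rewrite !inE => /andP[Jk /eqP <-].
by rewrite inordK.
Qed.

End PatternCount.

(** * Positive definite matrices: determinant, semidefinite limits and coercivity *)

Section PositiveDefinite.
Context {R : realType} {n : nat}.
Implicit Types (A : 'M[R]_n) (u v w : 'cV[R]_n).

Definition bil A u v : R := (u^T *m A *m v) 0 0.

Lemma bilE A u v : bil A u v = \sum_i \sum_j u i 0 * A i j * v j 0.
Proof.
rewrite /bil mxE exchange_big /=; apply: eq_bigr => j _.
by rewrite mxE big_distrl; apply: eq_bigr => i _; rewrite mxE.
Qed.

Lemma quadratic_nneg_discriminant (a b c : R) :
  0 <= c -> (forall t, 0 <= a + 2 * t * b + t ^+ 2 * c) -> b ^+ 2 <= a * c.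
Proof.
move=> cge0 h.
have [c0|c0] := eqVneq c 0.
  have [->|b0] := eqVneq b 0; first by rewrite expr0n c0 mulr0.
  (* For c = 0 the expression is affine in t, and this t gives it the value -1. *)
  have := h (- (a + 1) / (2 * b)); rewrite c0 mulr0 addr0.
  have -> : 2 * (- (a + 1) / (2 * b)) * b = - (a + 1) by field; rewrite b0.
  lra.
have cp : 0 < c by rewrite lt_neqAle eq_sym c0.
(* The vertex of the parabola. *)
have := h (- b / c).
have -> : a + 2 * (- b / c) * b + (- b / c) ^+ 2 * c = (a * c - b ^+ 2) / c by field.
by rewrite ler_pdivlMr // mul0r subr_ge0.
Qed.

(** Cauchy-Schwarz for a positive semidefinite form, by expanding it at u + t v. *)
Lemma bil_cauchy A u v : A^T = A -> (forall w, 0 <= bil A w w) ->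
  bil A u v ^+ 2 <= bil A u u * bil A v v.
Proof.
move=> As A0; apply: quadratic_nneg_discriminant => // t.
have sym : bil A v u = bil A u v.
  by rewrite /bil -[in LHS](trmxK (v^T *m A *m u)) mxE !trmx_mul trmxK As mulmxA.
have -> : bil A u u + 2 * t * bil A u v + t ^+ 2 * bil A v v =
    bil A (u + t *: v) (u + t *: v); last exact: A0.
have mxD (B C : 'M[R]_1) : (B + C) 0 0 = B 0 0 + C 0 0 by rewrite mxE.
have mxZ a (B : 'M[R]_1) : (a *: B) 0 0 = a * B 0 0 by rewrite mxE.
rewrite [RHS]/bil (_ : (u + t *: v)^T = u^T + t *: v^T); last first.
  by apply/matrixP => i j; rewrite !mxE.
rewrite !(mulmxDl, mulmxDr) -!(scalemxAl, scalemxAr) !(mxD, mxZ).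
rewrite -/(bil A u u) -/(bil A v v) -/(bil A u v) -/(bil A v u) sym.
by ring.
Qed.

(** The determinant is the value at 0 of the characteristic polynomial of - A. A root a >= 0 would
    give a vector with form value - a |v| ^ 2 <= 0; a monic polynomial without roots on the
    half-line a >= 0 is positive there. *)
Lemma posdef_det_gt0 A : posdef A -> 0 < \det A.
Proof.
move=> [As Apos]; have noroot a : 0 <= a -> ~~ root (char_poly (- A)) a.
  move=> a0; rewrite -eigenvalue_root_char; apply/negP => /eigenvalueP[v vA v0].
  have : 0 < (v^T^T *m A *m v^T) 0 0 
    by apply: Apos; apply: contra_neq v0 => /(congr1 trmx); rewrite trmxK trmx0.
  rewrite trmxK; have -> : v *m A = - a *: v by rewrite scaleNr -vA mulmxN opprK.
  rewrite -scalemxAl mxE mulNr oppr_gt0 ltNge mulr_ge0 // mxE.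
  by apply: sumr_ge0 => i _; rewrite mxE -expr2 sqr_ge0.
have -> : \det A = (char_poly (- A)).[0].
  by rewrite horner_coef0 char_poly_det -detZ scaleN1r opprK.
set q := char_poly _ in noroot *.
rewrite lt_neqAle eq_sym -[q.[0] != 0]/(~~ root q 0) noroot //= leNgt; apply/negP => q0.
have lq : 0 < lead_coef q by rewrite (monicP (char_poly_monic _)) ltr01.
have [m mP] := polyrcf.poly_pinfty_gt_lc lq.
have m0 : 0 <= Num.max 0 m by rewrite le_max lexx.
have /(poly_ivt m0)[x] : q.[0] <= 0 <= q.[Num.max 0 m].
  by rewrite (ltW q0) (le_trans (ltW lq)) // mP // le_max lexx orbT.
by move=> /andP[x0 _]; apply/negP; exact: noroot.
Qed.

Lemma bil_delta A i v : bil A (delta_mx i 0) v = (A *m v) i 0.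
Proof. by rewrite /bil -mulmxA trmx_delta -rowE mxE. Qed.

(** If the form vanishes at v, Cauchy-Schwarz against the basis vectors gives A v = 0. This lets
    positive definiteness with det bounded below be expressed by closed conditions. *)
Lemma possemidef_det A : A^T = A -> (forall v, 0 <= bil A v v) -> \det A != 0 -> posdef A.
Proof.
move=> As A0 dA; split=> // v v0; rewrite -/(bil A v v) lt_neqAle A0 andbT eq_sym.
apply: contra_neq v0 => vv; have uA : A \in unitmx by rewrite unitmxE unitfE.
suff Av : A *m v = 0 by rewrite -(mulKmx uA v) Av mulmx0.
apply/colP => i; rewrite -bil_delta [RHS]mxE; apply/eqP; rewrite -sqrf_eq0.
by rewrite eq_le sqr_ge0 andbT -(mulr0 (bil A (delta_mx i 0) (delta_mx i 0))) -vv bil_cauchy.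
Qed.

(** With u_i = A^-1 e_i one has v_i = bil A u_i v, so v_i ^ 2 <= bil A u_i u_i * bil A v v by
    Cauchy-Schwarz; sum over i. *)
Lemma posdef_coercive A : posdef A ->
  exists2 c, 0 < c & forall v, c * \sum_i v i 0 ^+ 2 <= bil A v v.
Proof.
move=> pA; have [As Apos] := pA.
have A0 v : 0 <= bil A v v.
  have [->|/Apos/ltW//] := eqVneq v 0.
  by rewrite /bil mulmx0 mxE.
have uA : A \in unitmx by rewrite unitmxE unitfE gt_eqF // posdef_det_gt0.
pose u i : 'cV[R]_n := invmx A *m delta_mx i 0.
have uv i v : bil A (u i) v = v i 0.
  by rewrite /bil /u trmx_mul trmx_inv As trmx_delta mulmxKV // -rowE mxE.
pose tau := \sum_i bil A (u i) (u i).
have tau0 : 0 <= tau by apply: sumr_ge0.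
exists (tau + 1)^-1 => [|v]; first by rewrite invr_gt0 ltr_wpDl.
rewrite mulrC ler_pdivrMr ?ltr_wpDl // mulrDr mulr1.
apply: (@le_trans _ _ (bil A v v * tau)); last by rewrite lerDl.
rewrite /tau mulr_sumr; apply: ler_sum => i _.
by rewrite -(uv i v) mulrC bil_cauchy.
Qed.

End PositiveDefinite.

(** * Families of symmetric matrices with polynomial entries *)

Section PosdefFamily.
Context {R : realType} {k n : nat}.

Lemma polyfun_det d (M : 'rV[R]_k -> 'M[R]_n) :
  (forall i j, polyfun d (fun x => M x i j)) -> polyfun (n * d) (fun x => \det (M x)).
Proof.
move=> Md; apply: polyfun_sum => s _; apply: polyfunZ.
apply: (@polyfun_leq _ _ (\sum_(i < n) d)%N); first by rewrite sum_nat_const card_ord.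
by apply: polyfun_prod => i _; exact: Md.
Qed.

Lemma polyfun_bil d (M : 'rV[R]_k -> 'M[R]_n) u v :
  (forall i j, polyfun d (fun x => M x i j)) -> polyfun d (fun x => bil (M x) u v).
Proof.
move=> Md; apply: (@eq_polyfun _ _ _
    (fun x => \sum_i \sum_j u i 0 * v j 0 * M x i j)) => [x|].
  by rewrite bilE; do 2!apply: eq_bigr => ? _; rewrite mulrAC.
by do 2!apply: polyfun_sum => ? _; apply: polyfunZ.
Qed.

(** Perturbation: if the entries of M y deviate from those of M x by [e y] < c in total, c the
    coercivity constant at x, the form of M y is still at least (c - e y) |v| ^ 2. *)
Lemma posdef_open d (M : 'rV[R]_k -> 'M[R]_n) :
  (forall i j, polyfun d (fun x => M x i j)) -> (forall x, (M x)^T = M x) ->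
  open [set x | posdef (M x)].
Proof.
move=> Md Ms; rewrite openE => x /= px; have [c c0 cP] := posdef_coercive px.
pose e y := \sum_i \sum_j `|M y i j - M x i j|.
have ec : continuous e.
  apply: continuous_big => [|i _]; first exact: add_continuous.
  apply: continuous_big => [|j _ y]; first exact: add_continuous.
  apply: (continuous_comp (f := fun y => M y i j - M x i j)); last exact: norm_continuous.
  apply: (@polyfun_continuous _ _ d); apply: polyfunD => //.
  exact: (polyfun_cst _ (- M x i j)).
have /ec : nbhs (e x) [set t | t < c].
  apply: open_nbhs_nbhs; split; first exact: open_lt.
  by rewrite /= /e big1 // => i _; rewrite big1 // => j _; rewrite subrr normr0.
apply: (@filterS _ (nbhs x)) => y ey; split=> [|v v0]; first exact: Ms.
rewrite -/(bil _ _ _); set nv := \sum_i v i 0 ^+ 2.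
have nv0 : 0 < nv.
  rewrite lt_neqAle sumr_ge0 ?andbT => [|i _]; last exact: sqr_ge0.
  rewrite eq_sym; apply: contra v0; rewrite psumr_eq0 => [/allP h|i _]; last exact: sqr_ge0.
  apply/eqP/colP => i; rewrite mxE; apply/eqP; rewrite -sqrf_eq0.
  exact: h (mem_index_enum i).
have v2 i : v i 0 ^+ 2 <= nv.
  by rewrite /nv (bigD1 i) //= lerDl sumr_ge0 // => j _; exact: sqr_ge0.
have -> : bil (M y) v v = bil (M x) v v + \sum_i \sum_j (M y i j - M x i j) * (v i 0 * v j 0).
  rewrite !bilE -big_split /=; apply: eq_bigr => i _; rewrite -big_split /=.
  by apply: eq_bigr => j _; ring.
apply: (@lt_le_trans _ _ ((c - e y) * nv)); first by rewrite mulr_gt0 // subr_gt0.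
rewrite mulrBl; apply: lerD; first exact: cP.
rewrite -lerN2 opprK -sumrN /e mulr_suml; apply: ler_sum => i _.
rewrite -sumrN mulr_suml; apply: ler_sum => j _; rewrite -mulNr.
apply: (le_trans (ler_norm _)); rewrite normrM normrN ler_wpM2l //.
(* Here |v_i v_j| <= |v| ^ 2 follows from (v_i + v_j) ^ 2 >= 0 and (v_i - v_j) ^ 2 >= 0. *)
rewrite ler_norml; move: (v2 i) (v2 j) (sqr_ge0 (v i 0 + v j 0)) (sqr_ge0 (v i 0 - v j 0)).
by move=> *; apply/andP; split; nra.
Qed.

Lemma posdef_shatter_bound d N (M : 'I_N -> 'rV[R]_k -> 'M[R]_n) :
  (0 < n)%N -> (0 < d)%N ->
  (forall q i j, polyfun d (fun x => M q x i j)) -> (forall q x, (M q x)^T = M q x) ->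
  (forall S : {set 'I_N}, exists x, forall q, posdef (M q x) <-> q \in S) ->
  (2 ^ N <= (2 * (n * d).*2.-1) ^ k * \sum_(j < k.+1) 'C(N, j))%N.
Proof.
move=> n0 d0 Md Ms shat.
have detc q : continuous (fun x => \det (M q x)) := polyfun_continuous (polyfun_det (Md q)).
apply: (@shatter_card_bound R k N (n * d) (fun q x => \det (M q x))
  (fun q => [set x | posdef (M q x)])) => //.
- by rewrite muln_gt0 n0.
- by move=> q; exact: polyfun_det.
- by move=> q x; exact: posdef_det_gt0.
(* Given det >= dl > 0, definiteness is equivalent to semidefiniteness, an intersection of closed
   conditions. *)
- move=> q dl dl0; rewrite (_ : mkset _ = (\bigcap_(v in setT)
      [set x | 0 <= bil (M q x) v v]) `&` [set x | dl <= \det (M q x)]).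
    apply: closedI.
      apply: closed_bigI => v _; apply: (@closed_comp _ _ (fun x => bil (M q x) v v) [set x | 0 <= x]).
        by move=> x _; apply: polyfun_continuous; apply: polyfun_bil (Md q).
      exact: closed_ge.
    by apply: (@closed_comp _ _ (fun x => \det (M q x)) [set x | dl <= x]); [move=> x _; exact: detc | exact: closed_ge].
  apply/seteqP; split=> x /=.
    case=> [[_ pos] dx]; split => // v _ /=; have [->|/pos/ltW//] := eqVneq v 0.
    by rewrite /bil mulmx0 mxE.
  case=> pos dx; split => //; apply: possemidef_det => // [v|]; first exact: pos.
  by rewrite gt_eqF // (lt_le_trans dl0).
- move=> q dl dl0; apply: openI; first exact: posdef_open (Md q) (Ms q).
  by apply: (@open_comp _ _ (fun x => \det (M q x)) [set x | dl < x]); [move=> x _; exact: detc | exact: open_gt].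
Qed.

End PosdefFamily.

(** * Numerical estimates turning the cell count into the logarithmic bound *)

Lemma binomial_sum_le {R : realType} (k N : nat) : (0 < k <= N)%N ->
  (\sum_(j < k.+1) 'C(N, j))%:R <= (expR 1 * (N%:R / k%:R)) ^+ k :> R.
Proof.
move=> /andP[k0 kN]; have N0 : (0 < N)%N by exact: leq_trans kN.
have kR : 0 < k%:R :> R by rewrite ltr0n.
have NR : 0 < N%:R :> R by rewrite ltr0n.
(* As x <= 1, x ^ k times the sum is at most the sum of C(N, j) x ^ j, hence at most (1 + x) ^ N <=
   exp (x N) = e ^ k. *)
pose x : R := k%:R / N%:R.
have x0 : 0 < x by rewrite divr_gt0.
have x1 : x <= 1 by rewrite ler_pdivrMr // mul1r ler_nat.
suff h : x ^+ k * (\sum_(j < k.+1) 'C(N, j))%:R <= expR 1 ^+ k.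
  have -> : expR 1 * (N%:R / k%:R) = expR 1 / x :> R by rewrite /x invf_div.
  by rewrite exprMn exprVn ler_pdivlMr ?exprn_gt0 // mulrC.
apply: (@le_trans _ _ ((1 + x) ^+ N)); last first.
  rewrite -expRM_natl mulr1; apply: (@le_trans _ _ (expR x ^+ N)).
    by rewrite lerXn2r ?nnegrE ?expR_ge0 ?expR_ge1Dx // addr_ge0 // ltW.
  by rewrite -expRM_natl /x mulrC divfK // gt_eqF.
rewrite exprDn natr_sum mulr_sumr.
apply: (@le_trans _ _ (\sum_(j < k.+1) x ^+ j *+ 'C(N, j))).
  apply: ler_sum => j _; rewrite -[leRHS]mulr_natr ler_wpM2r ?ler0n //.
  by apply: ler_wiXn2l; rewrite ?(ltW x0) // -ltnS.
under [leRHS]eq_bigr do rewrite expr1n mul1r.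
rewrite -!(big_mkord xpredT (fun j => x ^+ j *+ 'C(N, j))).
rewrite [leRHS](big_cat_nat (n := k.+1)) //= lerDl.
by apply: sumr_ge0 => j _; rewrite mulrn_wge0 // exprn_ge0 // ltW.
Qed.

(** From exp (1/64) >= 65/64 by six squarings, rounding down to a small fraction each time. *)
Lemma expR1_lower {R : realType} : (269 / 100) <= expR 1 :> R.
Proof.
have sq (a b x : R) : 0 <= a -> b <= a ^+ 2 -> a <= x -> b <= x ^+ 2.
  move=> a0 ba ax; apply: le_trans ba _.
  by rewrite lerXn2r // nnegrE // (le_trans a0).
have -> : expR 1 = (((((expR (64^-1 : R) ^+ 2) ^+ 2) ^+ 2) ^+ 2) ^+ 2) ^+ 2.
  by rewrite -!exprM -expRM_natl; congr expR; field.
apply: (@sq (151 / 92)); [lra | lra |].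
apply: (@sq (360 / 281)); [lra | lra |].
apply: (@sq (266 / 235)); [lra | lra |].
apply: (@sq (233 / 219)); [lra | lra |].
apply: (@sq (295 / 286)); [lra | lra |].
apply: (@sq (65 / 64)); [lra | lra |].
by apply: le_trans (expR_ge1Dx _); lra.
Qed.

(** Amounts to exp (-0.631) >= 1/2, obtained by raising exp (-0.631/4) >= 1 - 0.631/4 to the fourth
    power. *)
Lemma ln2_lower {R : realType} : (631 / 1000) <= ln 2 :> R.
Proof.
rewrite -[leLHS]expRK ler_ln ?posrE ?expR_gt0 ?ltr0n //.
have h : (3369 / 4000) <= expR (- (631 / 4000)) :> R by apply: le_trans (expR_ge1Dx _); lra.
have e0 := expR_gt0 (- (631 / 4000) : R).
have : 1 / 2 <= expR (- (631 / 1000)) :> R.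
  have -> : expR (- (631 / 1000) : R) = (expR (- (631 / 4000)) ^+ 2) ^+ 2.
    by rewrite -exprM -expRM_natl; congr expR; field.
  have h2 : (709 / 1000) <= expR (- (631 / 4000)) ^+ 2 :> R by nra.
  by nra.
have := expRxMexpNx_1 ((631 / 1000) : R); have := expR_gt0 ((631 / 1000) : R).
by nra.
Qed.

Lemma ln_le_sub1 {R : realType} (x : R) : 0 < x -> ln x <= x - 1.
Proof.
by move=> x0; have := expR_ge1Dx (ln x); rewrite lnK ?posrE // => h; lra.
Qed.

(** At A0 = 4e, where ln A0 = 2 ln 2 + 1, the numerical bounds suffice. Beyond A0 the tangent to ln
    at A0 applies, its slope 3 / A0 being at most ln 2 after multiplication by 3. *)
Lemma three_ln_le {R : realType} (A : R) : 4 * expR 1 <= A -> 3 * ln A <= A * ln 2.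
Proof.
move=> hA; have e := @expR1_lower R; have l := @ln2_lower R.
set A0 := 4 * expR 1 in hA; have A00 : 0 < A0 by rewrite /A0; lra.
have A0' : 0 < A by lra.
have lnA0 : ln A0 = 2 * ln 2 + 1.
  rewrite /A0 lnM ?posrE ?expR_gt0 // expRK; congr (_ + _).
  have -> : 4 = 2 * 2 :> R by ring.
  by rewrite lnM ?posrE //; ring.
have y1 : 1 <= A / A0 by rewrite ler_pdivlMr // mul1r.
have lnA : ln A <= ln A0 + (A / A0 - 1).
  rewrite -{1}(divfK (lt0r_neq0 A00) A) lnM ?posrE ?divr_gt0 // addrC lerD2l.
  by apply: ln_le_sub1; rewrite divr_gt0.
have hA0 : 3 * ln A0 <= A0 * ln 2 by rewrite lnA0 /A0; nra.
have : A * ln 2 = A0 * ln 2 + (A / A0 - 1) * (A0 * ln 2) by field; rewrite gt_eqF.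
have : 3 * (A / A0 - 1) <= (A / A0 - 1) * (A0 * ln 2).
  by rewrite mulrC ler_wpM2l ?subr_ge0 // (le_trans _ hA0) // lnA0; lra.
lra.
Qed.

(* With a = log_2 A, linearise ln at r = 2 a; three_ln_le is 3 a <= A. *)
Lemma le_two_log2 {R : realType} (A r : R) : 4 * expR 1 <= A -> 0 < r ->
  r * ln 2 <= ln (3 / 2 * A * r) -> r <= 2 * (ln A / ln 2).
Proof.
move=> hA r0 hr; have e := @expR1_lower R; have l := @ln2_lower R.
have A0 : 0 < A by lra.
have lnA1 : 1 <= ln A by rewrite -[leLHS](expRK 1) ler_ln ?posrE ?expR_gt0 //; lra.
set a := ln A / ln 2.
have a0 : 0 < a by rewrite divr_gt0 //; lra.
have aE : a * ln 2 = ln A by rewrite divfK // gt_eqF //; lra.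
have a3 : 3 * a <= A by rewrite /a mulrA ler_pdivrMr; [exact: three_ln_le | lra].
have h : ln (3 / 2 * A * r) <= ln A + ln A + (r / (2 * a) - 1).
  have -> : 3 / 2 * A * r = A * (3 * a) * (r / (2 * a)) by field; rewrite gt_eqF.
  have a30 : 0 < 3 * a by rewrite mulr_gt0.
  have ra0 : 0 < r / (2 * a) by rewrite divr_gt0 // mulr_gt0.
  have Aa0 : 0 < A * (3 * a) by rewrite mulr_gt0.
  rewrite (@lnM _ (A * (3 * a)) (r / (2 * a))) ?posrE // (@lnM _ A (3 * a)) ?posrE //.
  apply: lerD; last exact: ln_le_sub1.
  by rewrite lerD2l ler_ln ?posrE.
rewrite leNgt; apply/negP => ra.
(* If r > 2 a, the gap r ln 2 - 2 ln A equals (r / (2 a) - 1) * 2 ln A, and 2 ln A > 1 makes it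
   exceed the bound r / (2 a) - 1 from the linearisation. *)
have : (r / (2 * a) - 1) * 1 < (r / (2 * a) - 1) * (2 * ln A).
  rewrite ltr_pM2l; last by rewrite subr_gt0 ltr_pdivlMr ?mul1r // mulr_gt0.
  lra.
have : (r / (2 * a) - 1) * (2 * ln A) = r * ln 2 - 2 * ln A.
  by rewrite -aE; field; rewrite gt_eqF.
lra.
Qed.

Lemma vc_bound_ge {R : realType} (k n d N : nat) :
  (0 < k)%N -> (0 < n)%N -> (0 < d <= 2)%N ->
  (2 ^ N <= (2 * (n * d).*2.-1) ^ k * \sum_(j < k.+1) 'C(N, j))%N ->
  N%:R <= vc_bound R k n.
Proof.
move=> k0 n0 /andP[d0 d2] h.
have e := @expR1_lower R; have l := @ln2_lower R.
have kR : 0 < k%:R :> R by rewrite ltr0n.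
have n1 : 1 <= n%:R :> R by rewrite ler1n.
set A : R := 4 * expR 1 * n%:R ^+ 2.
have hA : 4 * expR 1 <= A by rewrite /A ler_peMr ?exprn_ege1 //; lra.
have -> : vc_bound R k n = k%:R * (2 * (ln A / ln 2)) by rewrite /vc_bound -/A; ring.
(* The binomial estimate needs k <= N; for N < k the ratio N / k is below 1 and the claim is
   immediate. *)
rewrite mulrC -ler_pdivrMr //; case: (ltnP N k) => [Nk|kN].
  apply: (@le_trans _ _ 1); first by rewrite ler_pdivrMr // mul1r ler_nat ltnW.
  have : 1 <= ln A / ln 2.
    by rewrite ler_pdivlMr ?mul1r ?ler_ln ?posrE //; lra.
  lra.
have N0 : (0 < N)%N by exact: leq_trans kN.
have NR : 0 < N%:R :> R by rewrite ltr0n.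
set r := N%:R / k%:R; have r0 : 0 < r by rewrite divr_gt0.
apply: le_two_log2 => //.
(* For d <= 2 the left side is at most 8n - 2, and 6n^2 - 8n + 2 = 2 (3n - 1) (n - 1) >= 0. *)
have base : (2 * (n * d).*2.-1)%:R <= 6 * n%:R ^+ 2 :> R.
  rewrite -natrX -(natrM _ 6) ler_nat; nia.
have h2 : 2 ^+ N <= (3 / 2 * A * r) ^+ k.
  have -> : 3 / 2 * A * r = (6 * n%:R ^+ 2) * (expR 1 * r) by rewrite /A; field.
  rewrite exprMn -natrX; apply: (@le_trans _ _ ((2 * (n * d).*2.-1) ^ k * \sum_(j < k.+1) 'C(N, j))%:R).
    by rewrite ler_nat.
  rewrite natrM natrX; apply: ler_pM; rewrite ?exprn_ge0 ?ler0n //.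
    by rewrite lerXn2r ?nnegrE // mulr_ge0 // exprn_ge0.
  by apply: binomial_sum_le; rewrite k0.
have A0 : 0 < A by apply: lt_le_trans hA; lra.
have Ar0 : 0 < 3 / 2 * A * r by rewrite mulr_gt0 // mulr_gt0 //; lra.
have : ln (2 ^+ N) <= ln ((3 / 2 * A * r) ^+ k) by rewrite ler_ln ?posrE ?exprn_gt0.
rewrite (lnXn N (ltr0n _ 2)) (lnXn k Ar0) -[ln 2 *+ N]mulr_natl -[_ *+ k]mulr_natl => hln.
by rewrite /r mulrAC ler_pdivrMr // mulrC [leRHS]mulrC mulrC.
Qed.

(** * The VC bound for polynomial families and its two instances *)

Lemma VCdim_posdef_family {R : realType} (k n l d : nat) (Q : set 'rV[R]_l)
    (M : 'rV[R]_k -> 'rV[R]_l -> 'M[R]_n) :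
  (0 < k)%N -> (0 < n)%N -> (0 < d <= 2)%N ->
  (forall q i j, polyfun d (fun x => M x q i j)) ->
  (forall x q, Q q -> symmetric_mx (M x q)) ->
  VCdim_le Q [set (fun q => ~~ `[< posdef (M x q) >]) | x in setT] (vc_bound R k n).
Proof.
move=> k0 n0 d12 Md Ms s us sQ shat; have /andP[d0 _] := d12.
apply: (vc_bound_ge k0 n0 d12).
apply: (posdef_shatter_bound (M := fun (q : 'I_(size s)) x => M x (nth 0 s q))) => //.
  by move=> q x; apply: Ms; apply/set_mem/sQ; exact: mem_nth.
(* Label 1 means not positive definite, so definiteness exactly on S requires shattering the
   complement of S. *)
move=> S; pose s' := [seq nth 0 s (i : 'I_(size s)) | i <- enum (~: S)].
have [|h [x _ <-] hs] := shat s'.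
  by move=> _ /mapP[i _ ->]; exact: mem_nth.
exists x => q; have := hs (nth 0 s q) (mem_nth 0 (ltn_ord q)).
have -> : (nth 0 s q \in s') = (q \notin S).
  apply/mapP/idP => [[i] | qS]; last by exists q; rewrite // mem_enum finset.inE.
  rewrite mem_enum finset.inE => iS /eqP; rewrite nth_uniq // => /eqP/val_inj -> //.
move=> /(congr1 negb); rewrite !negbK => <-; split; first by move=> ?; apply/asboolP.
by move/asboolP.
Qed.

Lemma linear_comb_symmetric {R : realType} n m (c : 'I_m -> R) (A : 'I_m -> 'M[R]_n) :
  (forall i, symmetric_mx (A i)) -> symmetric_mx (\sum_i c i *: A i).
Proof.
move=> As; rewrite /symmetric_mx linear_sum; apply: eq_bigr => i _.
by rewrite linearZ /= As.
Qed.

Theorem theorem2 (R : realType) (n l mx my : nat) (Q : set 'rV[R]_l) :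
  (0 < n)%N -> (0 < l)%N -> (0 < mx)%N -> (0 < my)%N ->
  (forall (F0 : 'rV[R]_l -> 'M[R]_n) (F : 'I_mx -> 'rV[R]_l -> 'M[R]_n),
     (forall q, Q q -> symmetric_mx (F0 q)) ->
     (forall i q, Q q -> symmetric_mx (F i q)) ->
     VCdim_le Q (family_LMI F0 F) (vc_bound R mx n))
  /\
  (forall (F0 : 'rV[R]_l -> 'M[R]_n) (F : 'I_mx -> 'rV[R]_l -> 'M[R]_n)
          (G : 'I_my -> 'rV[R]_l -> 'M[R]_n)
          (H : 'I_mx -> 'I_my -> 'rV[R]_l -> 'M[R]_n),
     (forall q, Q q -> symmetric_mx (F0 q)) ->
     (forall i q, Q q -> symmetric_mx (F i q)) ->
     (forall j q, Q q -> symmetric_mx (G j q)) ->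
     (forall i j q, Q q -> symmetric_mx (H i j q)) ->
     VCdim_le Q (family_BMI F0 F G H) (vc_bound R (mx + my) n)).
Proof.
move=> n0 l0 mx0 my0; split=> [F0 F F0s Fs|F0 F G H F0s Fs Gs Hs].
  (* The entries are affine in x, hence degree 1. *)
  apply: (@VCdim_posdef_family R mx n l 1) => // [q i j|x q Qq].
    apply: (@eq_polyfun _ _ _ (fun x => F0 q i j + \sum_a F a q i j * x 0 a)) => [x|].
      rewrite /F_LMI !mxE summxE; congr (_ + _); apply: eq_bigr => a _.
      by rewrite mxE mulrC.
    apply: polyfunD; first exact: polyfun_cst.
    by apply: polyfun_sum => a _; apply: polyfunZ; exact: polyfun_coord.
  rewrite /symmetric_mx /F_LMI linearD /= F0s //; congr (_ + _).
  by apply: linear_comb_symmetric => a; exact: Fs.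
(* The pair (x, y) becomes one row vector of length mx + my, which leaves the family unchanged; the
   products x_i y_j make the entries of degree 2. *)
pose M (x : 'rV[R]_(mx + my)) := F_BMI F0 F G H (lsubmx x, rsubmx x).
have -> : family_BMI F0 F G H = [set (fun q => ~~ `[< posdef (M x q) >]) | x in setT].
  apply/seteqP; split=> _ [x _ <-]; last by exists (lsubmx x, rsubmx x).
  by exists (row_mx x.1 x.2) => //; rewrite /M row_mxKl row_mxKr -surjective_pairing.
apply: (@VCdim_posdef_family R _ n l 2) => // [|q i j|x q Qq].
- by rewrite addn_gt0 mx0.
- apply: (@eq_polyfun _ _ _ (fun x => F0 q i j + \sum_a F a q i j * x 0 (lshift my a)
      + \sum_b G b q i j * x 0 (rshift mx b)
      + \sum_a \sum_b H a b q i j * (x 0 (lshift my a) * x 0 (rshift mx b)))) => [x|].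
    rewrite /M /F_BMI /= !mxE !summxE; congr (_ + _ + _ + _).
    + by apply: eq_bigr => a _; rewrite !mxE mulrC.
    + by apply: eq_bigr => a _; rewrite !mxE mulrC.
    + apply: eq_bigr => a _; rewrite summxE; apply: eq_bigr => b _.
      by rewrite !mxE mulrC.
  have coord2 a : polyfun 2 (fun x : 'rV[R]_(mx + my) => x 0 a).
    by apply: polyfun_leq (polyfun_coord a).
  apply: polyfunD; last first.
    do 2!apply: polyfun_sum => ? _; apply: polyfunZ.
    exact: (polyfunM (polyfun_coord _) (polyfun_coord _)).
  apply: polyfunD; last by apply: polyfun_sum => b _; exact: polyfunZ.
  apply: polyfunD; first exact: polyfun_cst.
  by apply: polyfun_sum => a _; exact: polyfunZ.
rewrite /symmetric_mx /M /F_BMI !linearD /= F0s //; congr (_ + _ + _ + _).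
- by apply: linear_comb_symmetric => a; exact: Fs.
- by apply: linear_comb_symmetric => a; exact: Gs.
- rewrite linear_sum; apply: eq_bigr => a _.
  by apply: linear_comb_symmetric => b; exact: Hs.
Qed.
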